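(* Let $\mathsf{K}$ be a variety of Brouwerian algebras that has finite depth. Then every $\mathsf{K}$-epimorphism is surjective.
   Context: A Brouwerian algebra is an algebra $\langle A;\to,\wedge,\vee,\top\rangle$ such that $\langle A;\wedge,\vee\rangle$ is a lattice with greatest element $\top$ and $x\wedge y\leqslant z\iff x\leqslant y\to z$ (there need not be a least element, and none is distinguished). Filters are non-empty lattice filters; a filter is prime if its complement is closed under $\vee$. The depth of a Brouwerian algebra $A$ is the supremum (in $\omega\cup\{\infty\}$) of the numbers of elements in finite chains, under inclusion, of proper prime filters of $A$ (it is $0$ if $A$ has no proper prime filter). The depth of a variety of Brouwerian algebras is the supremum of the depths of its members; the variety has finite depth if this supremum is finite. A class $\mathsf{K}$ of similar algebras is regarded as a category whose morphisms are all algebraic homomorphisms between members of $\mathsf{K}$. A $\mathsf{K}$-morphism $h\colon A\to B$ is a $\mathsf{K}$-epimorphism if, for all $\mathsf{K}$-morphisms $f,g$ from $B$ to a single member of $\mathsf{K}$, $f\circ h=g\circ h$ implies $f=g$. *)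

(* Defs.v *)
From HB Require Import structures.
From mathcomp Require Import all_boot all_order all_algebra.
From mathcomp Require Import boolp classical_sets functions cardinality.
From mathcomp Require Import constructive_ereal.

Set Implicit Arguments.
Unset Strict Implicit.
Unset Printing Implicit Defensive.

Import Order.Theory GRing.Theory Num.Theory.

Local Open Scope classical_set_scope.
Local Open Scope card_scope.
Local Open Scope order_scope.

HB.mixin Record TLattice_isBrouwerian d T of Order.TLattice d T := {
  impl : T -> T -> T;
  leI_impl : forall x y z : T, (x `&` y <= z) = (x <= impl y z)
}.

#[short(type="brouwerianType")]
HB.structure Definition Brouwerian d :=
  { T of Order.TLattice d T & TLattice_isBrouwerian d T }.

(* Varieties are taken as equational classes; Birkhoff's theorem identifies
   them with the classes closed under H, S and P. *)
Inductive term : Type :=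
| TVar of nat
| TTop
| TMeet of term & term
| TJoin of term & term
| TImpl of term & term.

Fixpoint teval d (A : brouwerianType d) (v : nat -> A) (t : term) : A :=
  match t with
  | TVar i => v i
  | TTop => \top
  | TMeet s u => teval v s `&` teval v u
  | TJoin s u => teval v s `|` teval v u
  | TImpl s u => impl (teval v s) (teval v u)
  end.

Definition models d (E : term -> term -> Prop) (A : brouwerianType d) : Prop :=
  forall s t, E s t -> forall v : nat -> A, teval v s = teval v t.

Definition variety d (K : brouwerianType d -> Prop) : Prop :=
  exists E : term -> term -> Prop, forall A, K A <-> models E A.

Definition lattice_filter d (A : brouwerianType d) (F : set A) : Prop :=
  [/\ F !=set0,
      forall x y, F x -> x <= y -> F y &
      forall x y, F x -> F y -> F (x `&` y)].

(* A itself is prime in this sense, hence the separate [proper_prime]. *)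
Definition prime_filter d (A : brouwerianType d) (F : set A) : Prop :=
  lattice_filter F /\
  forall x y, (~` F) x -> (~` F) y -> (~` F) (x `|` y).

Definition proper_prime d (A : brouwerianType d) (F : set A) : Prop :=
  prime_filter F /\ F != setT.

Definition chain_size d (A : brouwerianType d) (n : nat) : Prop :=
  exists C : set (set A),
    [/\ C `<=` @proper_prime d A, total_on C subset & C #= `I_n].

(* The values lie in the copy of omega + {oo} inside [\bar int]; by [depthP]
   and [variety_depthP] below they are the intended suprema. *)
Definition depth d (A : brouwerianType d) : \bar int :=
  supremum 0%E [set (Posz n)%:E%E | n in @chain_size d A].

Definition variety_depth d (K : brouwerianType d -> Prop) : \bar int :=
  supremum 0%E [set e | exists A : brouwerianType d, K A /\ e = depth A].

Definition finite_depth d (K : brouwerianType d -> Prop) : Prop :=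
  (variety_depth K < +oo)%E.

Definition brouwerian_hom d (A B : brouwerianType d) (f : A -> B) : Prop :=
  [/\ {morph f : x y / impl x y},
      Order.meet_morphism f,
      Order.join_morphism f &
      f \top = \top].

Definition K_morphism d (K : brouwerianType d -> Prop)
    (A B : brouwerianType d) (f : A -> B) : Prop :=
  [/\ K A, K B & brouwerian_hom f].

Definition K_epimorphism d (K : brouwerianType d -> Prop)
    (A B : brouwerianType d) (h : A -> B) : Prop :=
  K_morphism K h /\
  forall (C : brouwerianType d) (f g : B -> C),
    K_morphism K f -> K_morphism K g -> f \o h =1 g \o h -> f =1 g.

Lemma esup_nat (S : set (\bar int)) :
  S !=set0 ->
  (forall e, S e -> e = +oo%E \/ exists n : nat, e = (Posz n)%:E%E) ->
  supremums S (supremum 0%E S) /\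
  (supremum 0%E S = +oo%E \/ exists n : nat, supremum 0%E S = (Posz n)%:E%E).
Proof.
move=> S0 Sn.
suff [s ss sn] : exists2 s, supremums S s &
    s = +oo%E \/ exists n : nat, s = (Posz n)%:E%E.
  have sup : supremums S (supremum 0%E S).
    rewrite /supremum ifF; first by apply: xgetPex; exists s.
    by apply/negbTE/set0P.
  by split=> //; rewrite (is_subset1_supremums sup ss).
have [exm|nub] := pselect (exists m : nat, `[< ubound S (Posz m)%:E%E >]).
  case: (ex_minnP exm) => m /asboolP ub minm.
  exists (Posz m)%:E%E; last by right; exists m.
  split=> // -[[k|k]||] ubk; rewrite ?leey //.
  - by rewrite lee_fin lez_nat minm//; apply/asboolP.
  - have [e Se] := S0; have := ubk _ Se.
    by case: (Sn _ Se) => [->|[n ->]]; rewrite ?leye_eq // lee_fin.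
  - have [e Se] := S0; have := ubk _ Se.
    by case: (Sn _ Se) => [->|[n ->]].
exists +oo%E; last by left.
split=> [e _|]; first exact: leey.
move=> [k||] ubk; rewrite ?leey //; exfalso; apply: nub.
  exists `|k|%N; apply/asboolP => e /ubk /le_trans; apply.
  by rewrite lee_fin abszE ler_norm.
exists 0%N; apply/asboolP => e /ubk.
by rewrite leeNy_eq => /eqP->.
Qed.

Lemma depthP d (A : brouwerianType d) :
  supremums [set (Posz n)%:E%E | n in @chain_size d A] (depth A) /\
  (depth A = +oo%E \/ exists n : nat, depth A = (Posz n)%:E%E).
Proof.
apply: esup_nat => [|_ [n _ <-]]; last by right; exists n.
exists 0%E, 0%N => //; exists set0; split => //.
by rewrite II0.
Qed.

Lemma variety_depthP d (K : brouwerianType d -> Prop) :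
  (exists A, K A) ->
  supremums [set e | exists A : brouwerianType d, K A /\ e = depth A]
    (variety_depth K) /\
  (variety_depth K = +oo%E \/
   exists n : nat, variety_depth K = (Posz n)%:E%E).
Proof.
move=> [A KA]; apply: esup_nat => [|_ [B [_ ->]]]; last by have [] := depthP B.
by exists (depth A), A.
Qed.

(* Main.v *)
From HB Require Import structures.
Require Import Defs.
From mathcomp Require Import all_boot all_order ssrint.
From mathcomp Require Import boolp classical_sets cardinality.
From mathcomp Require Import constructive_ereal.

(** Let S be the range of h and suppose that S is not all of B. The aim is an
    algebra C of K with two distinct homomorphisms f, g : B -> C that agree
    on S, contradicting that h is epic. They are found through the prime
    filters of B; here B itself counts as an (improper) prime filter.

    Say that prime filters F and F' are twins if they are distinct but have the
    same trace on S. Separating an element outside S from S by prime filters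
    gives twins ([twins_exist]), because S is closed under implication and so
    prime filters with a prescribed trace lift along inclusions
    ([prime_lift]). Since B has finite depth, twins can be chosen of least
    possible depth. Lifting what lies above one twin to what lies above the
    other, minimality forces one of two local pictures ([adjacent_twins]):
    either F' is the unique least prime filter properly above F, or F and F'
    have the same prime filters properly above them. In either case the
    quotient map f : B -> B/F admits a rival. In terms of dual spaces, f is
    the inclusion of the up-set of F, and the rival moves the single point F
    to F' and fixes the rest.

    That the rival is an algebraic homomorphism g requires F to be isolated in
    its up-set, that is, B/F must have a greatest element c among those other
    than its top. This is a second use of finite depth: the formulas that bound
    the depth of a Brouwerian algebra, built from terms a \/ (a -> t), provide
    an element outside F that belongs to every prime filter properly above F
    ([prime_depth_witness], [prime_opremum]). Then g sends x to the top if x is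
    in F', and to f x /\ c otherwise ([twist_hom]). It agrees with f exactly at
    the elements on which F and F' agree, so on all of S but not on B. Finally
    B/F is in K because equations pass to quotients ([variety_quot]). *)

Set Implicit Arguments.
Unset Strict Implicit.
Unset Printing Implicit Defensive.

Import Order.Theory.

Local Open Scope classical_set_scope.
Local Open Scope order_scope.
Local Open Scope quotient_scope.

(** * Arithmetic of implication *)

Section BrouwerianArithmetic.
Context {d : Order.disp_t} {B : brouwerianType d}.
Implicit Types x y z : B.

Lemma implI_le x y : impl x y `&` x <= y.
Proof. by rewrite leI_impl. Qed.

Lemma le_impl x y : y <= impl x y.
Proof. by rewrite -leI_impl leIl. Qed.

Lemma impl_eq1 x y : x <= y -> impl x y = \top.
Proof. by move=> xy; apply/eqP; rewrite -le1x -leI_impl meet1x. Qed.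

Lemma impl1x x : impl \top x = x.
Proof.
by apply/le_anti; rewrite le_impl andbT -[leLHS]meetx1 implI_le.
Qed.

Lemma impl_mono x y z t : y <= x -> z <= t -> impl x z <= impl y t.
Proof.
move=> yx zt; rewrite -leI_impl; apply: le_trans zt.
by apply: le_trans (implI_le x z); apply: leI2.
Qed.

Lemma impl_trans x y z : impl x y `&` impl y z <= impl x z.
Proof.
rewrite -leI_impl meetAC; apply: le_trans (implI_le y z).
by rewrite meetC; apply: leI2 => //; apply: implI_le.
Qed.

Lemma le_implIr x y z : impl x y `&` impl x z <= impl x (y `&` z).
Proof.
rewrite -leI_impl lexI; apply/andP; split.
  by rewrite meetAC leIxl// implI_le.
by rewrite -meetA leIxr// implI_le.
Qed.

Lemma le_implUl x y z : impl x z `&` impl y z <= impl (x `|` y) z.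
Proof.
rewrite -leI_impl [leLHS]meetC leI_impl leUx -!leI_impl.
apply/andP; split; rewrite [leLHS]meetC.
  by rewrite meetAC leIxl// implI_le.
by rewrite -meetA leIxr// implI_le.
Qed.

Lemma impl_curry x y z : impl (x `&` y) z = impl x (impl y z).
Proof.
apply/le_anti/andP; split; first by rewrite -!leI_impl -meetA implI_le.
by rewrite -leI_impl meetA leI_impl implI_le.
Qed.

Lemma brouwerian_meetUl x y z : (x `|` y) `&` z <= (x `&` z) `|` (y `&` z).
Proof.
by rewrite leI_impl leUx -!leI_impl leUl leUr.
Qed.
End BrouwerianArithmetic.

(** * Filters and the prime filter theorem *)

Section Filters.
Context {d : Order.disp_t} {B : brouwerianType d}.
Implicit Types (x y z : B) (F G Z S : set B).

Lemma filter_top F : lattice_filter F -> F \top.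
Proof. by case=> [[x Fx] up _]; apply: up Fx _; rewrite lex1. Qed.

Lemma filter2 F x y z : lattice_filter F -> F x -> F y -> x `&` y <= z -> F z.
Proof. by case=> [_ up FI] Fx Fy; apply: up; apply: FI. Qed.

Lemma filter_le F x z : lattice_filter F -> F x -> x <= z -> F z.
Proof. by case=> _ + _ => /[apply] /[apply]. Qed.

Lemma filter_mp F x y : lattice_filter F -> F (impl x y) -> F x -> F y.
Proof. by move=> FF Fxy Fx; apply: (filter2 FF Fxy Fx); apply: implI_le. Qed.

Lemma prime_filterU F x y : prime_filter F -> F (x `|` y) -> F x \/ F y.
Proof.
move=> pF Fxy; have [Fx|Fx] := pselect (F x); [by left|right].
by apply: contrapT => Fy; apply: pF.2 Fxy.
Qed.

Lemma filter1 : lattice_filter [set \top : B].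
Proof.
split; first by exists \top.
  by move=> x y ->; rewrite le1x => /eqP.
by move=> x y -> ->; rewrite meetxx.
Qed.

(** When T is non-empty and closed under meets, this is the filter generated by
    F and T: by residuation, z lies above u `&` s for some u in F exactly when
    s -> z is in F. *)
Definition filter_join F T : set B := [set z | exists2 s, T s & F (impl s z)].

Lemma filter_join_filter F T : lattice_filter F -> T !=set0 ->
  (forall x y, T x -> T y -> T (x `&` y)) -> lattice_filter (filter_join F T).
Proof.
move=> FF [s Ts] TI; split.
- by exists s, s => //; rewrite impl_eq1//; apply: filter_top.
- move=> x y [t Tt Ftx] xy; exists t => //.
  by apply: (filter_le FF Ftx); apply: impl_mono.
- move=> x y [t Tt Ftx] [u Tu Fuy]; exists (t `&` u); first exact: TI.
  apply: (filter2 FF Ftx Fuy); apply: le_trans (le_implIr _ _ _).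
  by apply: leI2; apply: impl_mono; rewrite ?leIl ?leIr.
Qed.

Lemma filter_joinl F T : lattice_filter F -> T !=set0 -> F `<=` filter_join F T.
Proof.
move=> FF [s Ts] x Fx; exists s => //.
exact: (filter_le FF Fx (le_impl _ _)).
Qed.

Lemma filter_joinr F T : lattice_filter F -> T `<=` filter_join F T.
Proof.
by move=> FF x Tx; exists x => //; rewrite impl_eq1//; apply: filter_top.
Qed.

Lemma filter_join1_filter F x : lattice_filter F ->
  lattice_filter (filter_join F [set x]).
Proof.
move=> FF; apply: filter_join_filter => //; first by exists x.
by move=> _ _ -> ->; rewrite meetxx.
Qed.

(** Zorn's lemma for unions of chains also covers the empty chain, whose union
    is not a filter; adjoining F to every set of the chain repairs this. *)
Lemma filter_bigcup F (C : set (set B)) :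
  lattice_filter F -> (forall X, C X -> lattice_filter (F `|` X)) ->
  total_on C subset -> lattice_filter (F `|` \bigcup_(X in C) X).
Proof.
move=> FF CF totC.
have FXU X x : C X -> (F `|` X) x -> (F `|` \bigcup_(Y in C) Y) x.
  by move=> CX [|Xx]; [left|right; exists X].
split.
- by exists \top; left; apply: filter_top.
- move=> x y [Fx xy|[X CX Xx] xy]; first by left; apply: filter_le Fx xy.
  by apply: (FXU _ _ CX); apply: filter_le (CF _ CX) _ xy; right.
- have FX x y X : F x -> C X -> X y -> (F `|` \bigcup_(Y in C) Y) (x `&` y).
    move=> Fx CX Xy; apply: (FXU _ _ CX); have [_ _] := CF _ CX.
    by apply; [left|right].
  have XY X Y x y : C Y -> X `<=` Y -> X x -> Y y ->
      (F `|` \bigcup_(Y in C) Y) (x `&` y).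
    move=> CY XY Xx Yy; apply: (FXU _ _ CY); have [_ _] := CF _ CY.
    by apply; right => //; apply: XY.
  move=> x y [Fx|[X CX Xx]] [Fy|[Y CY Yy]].
  + by left; case: FF => _ _; apply.
  + exact: FX CY Yy.
  + by rewrite meetC; apply: FX CX Xx.
  + have [XsubY|YsubX] := totC _ _ CX CY; first exact: XY XsubY Xx Yy.
    by rewrite meetC; apply: XY YsubX Yy Xx.
Qed.

(** A filter G maximal among those that contain F and miss Z is prime: if x and
    y are outside G, then by maximality u -> z is in G for some z in Z, both
    for u = x and for u = y, so x `|` y in G would put a join of two elements
    of Z into G. Z may be empty, in which case G is improper. *)
Lemma prime_separation F Z : lattice_filter F ->
    (forall x y, Z x -> Z y -> Z (x `|` y)) -> (forall x, F x -> ~ Z x) ->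
  exists G, [/\ prime_filter G, F `<=` G & forall x, G x -> ~ Z x].
Proof.
move=> FF ZU FZ.
pose P X := lattice_filter (F `|` X) /\ forall x, X x -> ~ Z x.
have [C CP totC|X [[FX XZ] Xmax]] := @Zorn_bigcup _ P.
  split; last by move=> x [X CX Xx]; have [_] := CP _ CX; apply.
  by apply: filter_bigcup => // X /CP[].
have GZ x : (F `|` X) x -> ~ Z x by case; [apply: FZ|apply: XZ].
exists (F `|` X); split=> //; last by move=> x Fx; left.
split=> // x y Gx Gy.
suff : ~ (F `|` X) (x `|` y) by [].
move=> Gxy.
(* Maximality: the filter generated by [F `|` X] and u meets Z. *)
have meetZ u : ~ (F `|` X) u -> exists2 z, Z z & (F `|` X) (impl u z).
  move=> Gu; apply: contrapT => noz.
  have sub : F `|` X `<=` filter_join (F `|` X) [set u].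
    by apply: filter_joinl => //; exists u.
  apply: (Xmax (filter_join (F `|` X) [set u])).
    split; first by apply: subset_trans sub; apply: subsetUr.
    move=> /(_ u) Xu; apply: Gu; right; apply: Xu.
    exact: filter_joinr.
  split; first rewrite setUidr.
  + exact: filter_join1_filter.
  + by apply: subset_trans sub; apply: subsetUl.
  + by move=> z [_ -> Guz] Zz; apply: noz; exists z.
have [z Zz Gxz] := meetZ _ Gx; have [t Zt Gyt] := meetZ _ Gy.
apply: (GZ (z `|` t)); last exact: ZU.
apply: filter_mp Gxy => //; apply: (filter2 FX Gxz Gyt).
apply: le_trans (le_implUl _ _ _).
by apply: leI2; apply: impl_mono; rewrite ?leUl ?leUr.
Qed.

Lemma prime_impl F x y : lattice_filter F -> ~ F (impl x y) ->
  exists G, [/\ prime_filter G, F `<=` G, G x & ~ G y].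
Proof.
move=> FF Fxy.
have [||z [_ -> Fxz] zy|G [pG FG Gy]] :=
  @prime_separation (filter_join F [set x]) [set y].
- exact: filter_join1_filter.
- by move=> _ _ -> ->; rewrite joinxx.
- by apply: Fxy; rewrite -zy.
exists G; split=> //; last by move=> /Gy; apply.
  by apply: subset_trans FG; apply: filter_joinl => //; exists x.
by apply: FG; apply: filter_joinr.
Qed.

(** * Depth of prime filters *)

(** The improper filter has depth 0, so that the depth of a proper prime filter
    F is the largest size of a chain of proper prime filters with least element
    F. *)
Fixpoint prime_depth_le k F : Prop :=
  if k is k'.+1 then forall G, prime_filter G -> F `<` G -> prime_depth_le k' G
  else F = [set: B].

Lemma filter_properI F G x : F `<=` G -> G x -> ~ F x -> F `<` G.
Proof. by move=> FG Gx Fx; split=> // GF; apply/Fx/GF. Qed.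

Lemma proper_trans (X Y Z : set B) : X `<` Y -> Y `<` Z -> X `<` Z.
Proof.
move=> [XY nYX] [YZ _]; split; first exact: subset_trans YZ.
by move=> ZX; apply: nYX; apply: subset_trans ZX.
Qed.

Lemma prime_depth_leS k F : prime_depth_le k F -> prime_depth_le k.+1 F.
Proof.
elim: k F => [|k IH] F /=; last by move=> FP G pG FG; apply/IH/FP.
by move=> -> G _ [_]; case.
Qed.

Lemma prime_depth_le_subset k F G :
  prime_filter G -> F `<=` G -> prime_depth_le k F -> prime_depth_le k G.
Proof.
move=> pG FG dF; have [->//|nFG] := pselect (G = F).
case: k dF => [/= dF|k dF].
  by apply/seteqP; split=> // x _; apply: FG; rewrite dF.
by apply/prime_depth_leS/dF => //; split=> // GF; apply/nFG/seteqP.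
Qed.

(** The prime filters of depth at most k form a closed set, cut out by the
    bounded-depth formulas a `|` (a -> t): if t is outside G but in all of those
    of depth at most k, and a is in G but not in F, then a `|` (a -> t) is
    outside F but in all of those of depth at most k + 1. *)
Lemma prime_depth_witness k F : prime_filter F -> ~ prime_depth_le k F ->
  exists2 t, ~ F t & forall H, prime_filter H -> prime_depth_le k H -> H t.
Proof.
elim: k F => [|k IH] F pF.
  move=> FT; have [t Ft] : exists t, ~ F t.
    apply: contrapT => /forallNP FA; apply: FT; apply/seteqP.
    by split=> // t _; apply: contrapT; apply: FA.
  by exists t => // H _ ->.
move=> /existsNP[G /not_implyP[pG /not_implyP[FG /(IH _ pG)[t Gt tP]]]].
have [FsubG /existsNP[a /not_implyP[Ga Fa]]] := FG.
exists (a `|` impl a t) => [|H pH dH].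
  move=> /(prime_filterU pF)[//|Fat]; apply: Gt.
  by apply: (filter_mp pG.1 _ Ga); apply: FsubG.
apply: contrapT => Hat.
have Ha : ~ H a by move=> Ha; apply/Hat/(filter_le pH.1 Ha)/leUl.
have [|K [pK HK Ka Kt]] := @prime_impl H a t pH.1.
  by move=> Hi; apply/Hat/(filter_le pH.1 Hi)/leUr.
exact: Kt (tP K pK (dH K pK (filter_properI HK Ka Ha))).
Qed.

(** In terms of the quotient B/F: the class of c is the greatest element below
    the top. If F has depth exactly k + 1, what lies properly above F has depth
    at most k, and a single element separates F from all of it. *)
Lemma prime_opremum n F : prime_filter F -> F <> setT -> prime_depth_le n F ->
  exists2 c, ~ F c & forall G, prime_filter G -> F `<` G -> G c.
Proof.
move=> pF FT; elim: n => [//|n IH] dF.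
have [/IH//|ndF] := pselect (prime_depth_le n F).
have [c Fc cP] := prime_depth_witness pF ndF.
by exists c => // G pG FG; apply: cP => //; apply: dF.
Qed.

Lemma long_chain n F : prime_filter F -> ~ prime_depth_le n F ->
  exists c : nat -> set B, [/\ c 0%N = F,
    forall i, (i <= n)%N -> proper_prime (c i) &
    forall i j, (i < j <= n)%N -> c i `<` c j].
Proof.
elim: n F => [|n IH] F pF.
  move=> /= FT; exists (fun=> F); split=> // [i _|i j /andP[ij]].
    by split=> //; apply/eqP.
  by rewrite leqn0 => /eqP j0; rewrite j0 in ij.
move=> /[dup] ndF /existsNP[G /not_implyP[pG /not_implyP[FG]]].
move=> /(IH _ pG)[c [c0 cP cS]].
exists (fun i => if i is i'.+1 then c i' else F); split=> //.
- move=> [_|i]; last exact: cP.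
  split=> //; apply/eqP => FT; case: FG => _; apply; rewrite FT; exact: subsetT.
- move=> [|i] [|j]//; last exact: cS.
  move=> /andP[_]; rewrite ltnS; case: j => [|j] jn; first by rewrite c0.
  by rewrite -c0 in FG; apply: proper_trans FG (cS _ _ _).
Qed.

Lemma chain_size_bound n : (forall m, chain_size B m -> (m <= n)%N) ->
  forall F, prime_filter F -> prime_depth_le n F.
Proof.
move=> nP F pF; apply: contrapT => /(long_chain pF)[c [_ cP cS]].
suff /nP : chain_size B n.+1 by rewrite ltnn.
exists (c @` `I_n.+1); split.
- by move=> _ [i /= ni <-]; apply: cP.
- move=> _ _ [i /= ni <-] [j /= nj <-].
  have [ij|ji|->] := ltngtP i j; last by left.
  + by left; apply: properW; apply: cS; rewrite ij.
  + by right; apply: properW; apply: cS; rewrite ji.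
- apply: inj_card_eq => i j /set_mem/= ni /set_mem/= nj cij.
  have [ij|ji|//] := ltngtP i j.
  + by have := @properxx _ (c j); rewrite -{1}cij; case; apply: cS; rewrite ij.
  + by have := @properxx _ (c j); rewrite -{2}cij; case; apply: cS; rewrite ji.
Qed.

(** * Prime filters with the same trace on a subalgebra *)

Definition subuniverse S : Prop :=
  [/\ S \top, forall x y, S x -> S y -> S (x `&` y),
      forall x y, S x -> S y -> S (x `|` y) &
      forall x y, S x -> S y -> S (impl x y)].

Section Twins.
Variable S : set B.
Hypothesis subS : subuniverse S.

(** The filter generated by P and the trace of Q misses [S `\` Q]: if s is in
    Q and S, x in S, and s -> x in P, then s -> x is in the trace of P, hence
    in Q, and so is x. This is where closure of S under implication enters. *)
Lemma prime_lift P Q : lattice_filter P -> prime_filter Q -> P `&` S `<=` Q ->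
  exists G, [/\ prime_filter G, P `<=` G & G `&` S = Q `&` S].
Proof.
move=> FP pQ PSQ; have [S1 SI SU Simpl] := subS.
have QS0 : Q `&` S !=set0 by exists \top; split=> //; apply: filter_top pQ.1.
have [|||G [pG PG GZ]] := @prime_separation (filter_join P (Q `&` S)) (S `\` Q).
- apply: filter_join_filter => // x y [Qx Sx] [Qy Sy]; split; last exact: SI.
  by case: pQ.1 => _ _; apply.
- by move=> x y [Sx Qx] [Sy Qy]; split; [apply: SU|apply: pQ.2].
- move=> x [s [Qs Ss] Psx] [Sx Qx]; apply/Qx/(filter_mp pQ.1 _ Qs)/PSQ.
  by split=> //; apply: Simpl.
exists G; split=> //; first by apply: subset_trans PG; apply: filter_joinl.
apply/seteqP; split=> x [Gx Sx]; split=> //.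
  by apply: contrapT => Qx; apply: (GZ x).
by apply/PG/filter_joinr.
Qed.

(** Choose P containing b and avoiding the elements of S below b; then no
    element of P in S is below b, so some prime Q omits b and contains the trace
    of P. Lifting the trace of Q above P gives a prime filter that contains b
    and has the same trace as Q. *)
Lemma twins_exist b : ~ S b -> exists P Q,
  [/\ prime_filter P, prime_filter Q, P `&` S = Q `&` S & P <> Q].
Proof.
move=> Sb; have [S1 SI SU Simpl] := subS.
have [|||P [pP bP PZ]] :=
  @prime_separation (filter_join [set \top] [set b]) [set s | S s /\ s <= b].
- exact: filter_join1_filter filter1.
- by move=> x y [Sx xb] [Sy yb]; split; [apply: SU|rewrite leUx xb].
- move=> x [_ ->]/= /eqP; rewrite -le1x -leI_impl meet1x => bx [Sx xb].
  by apply: Sb; rewrite (_ : b = x)//; apply/le_anti; rewrite bx.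
have Pb : P b by apply/bP/filter_joinr => //; apply: filter1.
have PS0 : P `&` S !=set0 by exists \top; split=> //; apply: filter_top pP.1.
have [|||Q [pQ PQ Qb]] :=
  @prime_separation (filter_join [set \top] (P `&` S)) [set b].
- apply: filter_join_filter => //; first exact: filter1.
  move=> x y [Px Sx] [Py Sy]; split; last exact: SI.
  by case: pP.1 => _ _; apply.
- by move=> _ _ -> ->; rewrite joinxx.
- move=> x [s [Ps Ss]]/= + xb; rewrite xb => /eqP.
  by rewrite -le1x -leI_impl meet1x => sb; apply: (PZ s).
have [|G [pG PG GQ]] := prime_lift pP.1 pQ.
  by move=> x PSx; apply/PQ/filter_joinr => //; apply: filter1.
exists G, Q; split=> // GQe; apply: (Qb b) => //.
by rewrite -GQe; apply: PG.
Qed.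

(** The two local pictures in which moving F to F' respects the order on
    prime filters and its up-sets: F' is the least prime filter properly above
    F, or F and F' have the same prime filters properly above them. *)
Definition covered_by F F' : Prop := F `<` F' /\
  forall G, prime_filter G -> F `<` G -> F' `<=` G.

Definition same_above F F' : Prop :=
  forall G, prime_filter G -> (F `<` G <-> F' `<` G).

Definition twins F F' : Prop :=
  [/\ prime_filter F, prime_filter F', F `&` S = F' `&` S & F <> F'].

(** Take twins P and Q of least depth k + 1, so that prime filters of depth at
    most k are determined by their traces. A prime filter properly above P
    lifts to one above Q with the same trace, and the two coincide as soon as
    both have depth at most k. If some prime filter with the same trace lies
    properly above P or above Q, it covers it; otherwise no lift can stop at P
    or Q itself, and P and Q have the same prime filters properly above. *)
Lemma adjacent_twins n b :
  (forall F, prime_filter F -> prime_depth_le n F) -> ~ S b ->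
  exists F F', [/\ twins F F', F <> [set: B] &
    covered_by F F' \/ same_above F F'].
Proof.
move=> dn /twins_exist[P0 [Q0 tw0]].
(* Twins cannot both have depth 0, for both would be improper. *)
have [k [P [Q [tw dP dQ dmin]]]] : exists k P Q,
    [/\ twins P Q, prime_depth_le k.+1 P, prime_depth_le k.+1 Q &
      forall F G, twins F G -> prime_depth_le k F -> ~ prime_depth_le k G].
  have : exists P Q, [/\ twins P Q, prime_depth_le n P & prime_depth_le n Q].
    by exists P0, Q0; case: (tw0) => pP pQ _ _; split=> //; apply: dn.
  elim: n {dn} => [|n IH] [P [Q [tw dP dQ]]].
    by case: tw => _ _ _ []; rewrite dP dQ.
  have [/IH//|notw] := pselect (exists P Q,
    [/\ twins P Q, prime_depth_le n P & prime_depth_le n Q]).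
  exists n, P, Q; split=> // F G FG dF dG.
  by apply: notw; exists F, G.
have dinj F G : prime_filter F -> prime_filter G -> F `&` S = G `&` S ->
    prime_depth_le k F -> prime_depth_le k G -> F = G.
  move=> pF pG FGS dF dG; apply: contrapT => nFG.
  exact: dmin (And4 pF pG FGS nFG) dF dG.
have cover F F' : prime_filter F -> prime_filter F' -> F `&` S = F' `&` S ->
    prime_depth_le k.+1 F -> F `<` F' -> covered_by F F'.
  move=> pF pF' FF' dF FltF'; split=> // G pG FG.
  have [x [F'x Sx]|G' [pG' F'G' GG']] := prime_lift pF'.1 pG.
    have [Fx _] : (F `&` S) x by rewrite FF'.
    exact: FG.1 _ Fx.
  rewrite (_ : G = G')//; apply: dinj => //; first exact: dF.
  by apply: prime_depth_le_subset F'G' _ => //; apply: dF.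
have above F F' : prime_filter F -> prime_filter F' -> F `&` S = F' `&` S ->
    prime_depth_le k.+1 F -> prime_depth_le k.+1 F' ->
    (forall G, prime_filter G -> F `&` S = G `&` S -> ~ F `<` G) ->
    forall G, prime_filter G -> F `<` G -> F' `<` G.
  move=> pF pF' FF' dF dF' noF G pG FG.
  have [x [F'x Sx]|G' [pG' F'G' GG']] := prime_lift pF'.1 pG.
    have [Fx _] : (F `&` S) x by rewrite FF'.
    exact: FG.1 _ Fx.
  have F'ltG' : F' `<` G'.
    split=> // G'F'; apply: (noF G) => //.
    by rewrite FF' -GG'; congr (_ `&` _); apply/seteqP.
  rewrite (_ : G = G')//; apply: dinj => //; first exact: dF.
  exact: dF'.
have [pP pQ PQ nPQ] := tw.
have find F F' : twins F F' -> prime_depth_le k.+1 F -> F `<` F' ->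
    exists F F', [/\ twins F F', F <> [set: B] &
    covered_by F F' \/ same_above F F'].
  move=> [pF pF' FF' nFF'] dF FltF'; exists F, F'; split=> //.
    by move=> FT; case: FltF' => _; apply; rewrite FT.
  by left; apply: cover.
have tw_lt F G : prime_filter F -> prime_filter G -> F `&` S = G `&` S ->
    F `<` G -> twins F G.
  by move=> pF pG FG [_ GF]; split=> // FGe; apply: GF; rewrite FGe.
have [[G [pG PG PltG]]|noP] := pselect (exists G,
    [/\ prime_filter G, P `&` S = G `&` S & P `<` G]).
  exact: find (tw_lt _ _ pP pG PG PltG) dP PltG.
have [[G [pG QG QltG]]|noQ] := pselect (exists G,
    [/\ prime_filter G, Q `&` S = G `&` S & Q `<` G]).
  exact: find (tw_lt _ _ pQ pG QG QltG) dQ QltG.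
exists P, Q; split=> //.
  move=> PT; apply: noQ; exists P; split=> //; split; first by rewrite PT.
  by move=> sPQ; apply: nPQ; apply/seteqP; split=> //; rewrite PT.
right=> G pG; split; apply: above => // H pH eH ltH.
  by apply: noP; exists H.
by apply: noQ; exists H.
Qed.
End Twins.
End Filters.

(** * The quotient by a filter *)

Section FilterQuotient.
Context {d : Order.disp_t} {B : brouwerianType d}.
Variables (F : set B) (FF : lattice_filter F).
Implicit Types x y z : B.

Lemma filter_impl_trans x y z :
  F (impl x y) -> F (impl y z) -> F (impl x z).
Proof. by move=> Fxy Fyz; apply: (filter2 FF Fxy Fyz); apply: impl_trans. Qed.

Lemma filter_impl_le x y : x <= y -> F (impl x y).
Proof. by move=> xy; rewrite impl_eq1//; apply: filter_top. Qed.

Definition filter_eq x y : bool := `[< F (impl x y) /\ F (impl y x) >].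

Lemma filter_eq_refl : reflexive filter_eq.
Proof. by move=> x; apply/asboolP; split; apply: filter_impl_le. Qed.

Lemma filter_eq_sym : symmetric filter_eq.
Proof. by move=> x y; apply/asboolP/asboolP => -[]. Qed.

Lemma filter_eq_trans : transitive filter_eq.
Proof.
move=> y x z /asboolP[xy yx] /asboolP[yz zy]; apply/asboolP.
by split; [apply: filter_impl_trans yz|apply: filter_impl_trans yx].
Qed.

Canonical filter_equiv :=
  EquivRel filter_eq filter_eq_refl filter_eq_sym filter_eq_trans.

Definition filter_quot := {eq_quot filter_equiv}.
HB.instance Definition _ := Choice.on filter_quot.
HB.instance Definition _ := EqQuotient.on filter_quot.
Implicit Types X Y Z : filter_quot.

Definition quot_pi x : filter_quot := \pi_filter_quot x.

Lemma quot_piP x y : quot_pi x = quot_pi y <-> F (impl x y) /\ F (impl y x).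
Proof. by split=> [/eqquotP/asboolP//|xy]; apply/eqquotP/asboolP. Qed.

Lemma quot_pi_surj X : exists x, X = quot_pi x.
Proof. by exists (repr X); rewrite /quot_pi reprK. Qed.

Definition quot_le X Y : bool := `[< F (impl (repr X) (repr Y)) >].

Lemma repr_pi x :
  F (impl x (repr (quot_pi x))) /\ F (impl (repr (quot_pi x)) x).
Proof. by apply/quot_piP; rewrite /quot_pi reprK. Qed.

Lemma quot_le_pi x y : quot_le (quot_pi x) (quot_pi y) = `[< F (impl x y) >].
Proof.
have [x1 x2] := repr_pi x; have [y1 y2] := repr_pi y.
apply/asboolP/asboolP => xy.
  exact: filter_impl_trans (filter_impl_trans x1 xy) y2.
exact: filter_impl_trans (filter_impl_trans x2 xy) y1.
Qed.

Lemma quot_le_refl : reflexive quot_le.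
Proof. by move=> X; apply/asboolP/filter_impl_le. Qed.

Lemma quot_le_anti : antisymmetric quot_le.
Proof.
move=> X Y; have [x ->] := quot_pi_surj X; have [y ->] := quot_pi_surj Y.
by rewrite !quot_le_pi => /andP[/asboolP xy /asboolP yx]; apply/quot_piP.
Qed.

Lemma quot_le_trans : transitive quot_le.
Proof.
move=> Y X Z /asboolP XY /asboolP YZ; apply/asboolP.
exact: filter_impl_trans XY YZ.
Qed.

HB.instance Definition _ := Order.Le_isPOrder.Build d filter_quot
  quot_le_refl quot_le_anti quot_le_trans.

Lemma le_quot_pi x y : (quot_pi x <= quot_pi y) = `[< F (impl x y) >].
Proof. exact: quot_le_pi. Qed.

Definition quot_meet X Y := quot_pi (repr X `&` repr Y).
Definition quot_join X Y := quot_pi (repr X `|` repr Y).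
Definition quot_impl X Y := quot_pi (impl (repr X) (repr Y)).

Lemma quot_piK X : quot_pi (repr X) = X.
Proof. by rewrite /quot_pi reprK. Qed.

Lemma quot_lexI X Y Z : (X <= quot_meet Y Z) = (X <= Y) && (X <= Z).
Proof.
rewrite -[X]quot_piK -[in RHS](quot_piK Y) -[in RHS](quot_piK Z) /quot_meet.
rewrite !le_quot_pi; apply/asboolP/andP => [FX|[/asboolP XY /asboolP XZ]].
  split; apply/asboolP/(filter_le FF FX)/impl_mono => //.
    exact: leIl.
  exact: leIr.
by apply: (filter2 FF XY XZ); apply: le_implIr.
Qed.

Lemma quot_leUx X Y Z : (quot_join X Y <= Z) = (X <= Z) && (Y <= Z).
Proof.
rewrite -[Z]quot_piK -[in RHS](quot_piK X) -[in RHS](quot_piK Y) /quot_join.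
rewrite !le_quot_pi; apply/asboolP/andP => [FX|[/asboolP XY /asboolP XZ]].
  split; apply/asboolP/(filter_le FF FX)/impl_mono => //.
    exact: leUl.
  exact: leUr.
by apply: (filter2 FF XY XZ); apply: le_implUl.
Qed.

HB.instance Definition _ :=
  Order.POrder_isMeetSemilattice.Build d filter_quot quot_lexI.
HB.instance Definition _ :=
  Order.POrder_isJoinSemilattice.Build d filter_quot quot_leUx.

Lemma quot_lex1 X : X <= quot_pi \top.
Proof.
by rewrite -[X]quot_piK le_quot_pi; apply/asboolP/filter_impl_le; rewrite lex1.
Qed.

HB.instance Definition _ := Order.hasTop.Build d filter_quot quot_lex1.

Lemma quot_pi_meet x y : quot_pi (x `&` y) = quot_pi x `&` quot_pi y.
Proof.
apply/le_anti/andP; split.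
  rewrite lexI !le_quot_pi; apply/andP.
  by split; apply/asboolP/filter_impl_le; [exact: leIl|exact: leIr].
have [x1 x2] := repr_pi x; have [y1 y2] := repr_pi y.
rewrite [leLHS]/(quot_pi _) le_quot_pi; apply/asboolP.
apply: (filter2 FF x2 y2); apply: le_trans (le_implIr _ _ _).
by apply: leI2; apply: impl_mono; rewrite ?leIl ?leIr.
Qed.

Lemma quot_pi_join x y : quot_pi (x `|` y) = quot_pi x `|` quot_pi y.
Proof.
apply/le_anti/andP; split; last first.
  rewrite leUx !le_quot_pi; apply/andP.
  by split; apply/asboolP/filter_impl_le; [exact: leUl|exact: leUr].
have [x1 x2] := repr_pi x; have [y1 y2] := repr_pi y.
rewrite [leRHS]/(quot_pi _) le_quot_pi; apply/asboolP.
apply: (filter2 FF x1 y1); apply: le_trans (le_implUl _ _ _).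
by apply: leI2; apply: impl_mono; rewrite ?leUl ?leUr.
Qed.

Lemma quot_leI_impl X Y Z : (X `&` Y <= Z) = (X <= quot_impl Y Z).
Proof.
rewrite -(quot_piK X) -(quot_piK Y) -[in LHS](quot_piK Z) -quot_pi_meet.
by rewrite !le_quot_pi quot_piK impl_curry.
Qed.

HB.instance Definition _ :=
  TLattice_isBrouwerian.Build d filter_quot quot_leI_impl.

Lemma quot_pi_impl x y : quot_pi (impl x y) = impl (quot_pi x) (quot_pi y).
Proof.
apply/le_anti/andP; split.
  rewrite -leI_impl -quot_pi_meet le_quot_pi; apply/asboolP/filter_impl_le.
  exact: implI_le.
set Z := impl _ _; rewrite -[Z]quot_piK le_quot_pi -impl_curry -le_quot_pi.
by rewrite quot_pi_meet quot_piK implI_le.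
Qed.

Lemma quot_pi_hom : brouwerian_hom (quot_pi : B -> filter_quot).
Proof.
split=> //.
- exact: quot_pi_impl.
- exact: quot_pi_meet.
- exact: quot_pi_join.
Qed.

Lemma quot_pi_eq1 x : quot_pi x = \top <-> F x.
Proof.
rewrite quot_piP impl1x impl_eq1 ?lex1//.
by split=> [[]//|Fx]; split=> //; apply: filter_top.
Qed.

Lemma teval_quot_pi (v : nat -> B) t :
  teval (quot_pi \o v) t = quot_pi (teval v t).
Proof.
have [pimpl pmeet pjoin p1] := quot_pi_hom.
by elim: t => //= s -> u ->; rewrite ?pmeet ?pjoin ?pimpl.
Qed.

(** A valuation in the quotient lifts to B along representatives. *)
Lemma variety_quot (K : brouwerianType d -> Prop) :
  variety K -> K B -> K filter_quot.
Proof.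
move=> [E KE] /KE mB; apply/KE => s t Est v.
have -> : v = quot_pi \o (repr \o v) by apply/funext => i; rewrite /= quot_piK.
by rewrite !teval_quot_pi (mB _ _ Est).
Qed.
End FilterQuotient.

(** * Moving one prime filter *)

Section Twist.
Context {d : Order.disp_t} {B C : brouwerianType d}.
(** When f is the quotient by F, the dual of C is the up-set of F, in which c
    isolates the point F. The map [twist] redirects that point to F': the value
    at x keeps the part of f x below c, and membership of x in F' decides
    whether it is the top. Then [F'_le] says that every other point of the
    up-set contains F', and [F'_nle] that x -> y, if neither it nor x is in F',
    is refuted at a point other than F. *)
Variables (f : B -> C) (c : C) (F' : set B).
Hypotheses (homf : brouwerian_hom f) (pF' : prime_filter F').
Hypothesis opremum_c : forall z : C, z <> \top -> z <= c.
Hypothesis F'_le : forall x, F' x -> c <= f x.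
Hypothesis F'_nle : forall x y,
  ~ F' x -> ~ F' (impl x y) -> ~ c <= f (impl x y).

Definition twist (x : B) : C := if `[< F' x >] then \top else f x `&` c.

Lemma twist_in x : F' x -> twist x = \top.
Proof. by move=> /asboolP; rewrite /twist => ->. Qed.

Lemma twist_out x : ~ F' x -> twist x = f x `&` c.
Proof. by move=> /asboolPn/negbTE; rewrite /twist => ->. Qed.

(** The value of c -> z is not the top, so it is below c, hence below z. *)
Lemma impl_opremum z : ~ c <= z -> impl c z = z.
Proof.
move=> cz; apply/le_anti; rewrite le_impl andbT.
have ic : impl c z <= c.
  by apply: opremum_c => i1; apply: cz; rewrite -[c]meet1x leI_impl i1.
by apply: le_trans (implI_le c z); rewrite lexI lexx.
Qed.

(** The delicate case is an implication x -> y with neither x nor x -> y in F'.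
    There f (x -> y) is not above c by [F'_nle], so it equals c -> f (x -> y),
    which is the implication between the truncated values f x `&` c and
    f y `&` c. *)
Lemma twist_hom : brouwerian_hom twist.
Proof.
have [fimpl fmeet fjoin f1] := homf; have FF' := pF'.1.
have up x y : F' x -> x <= y -> F' y by move=> Fx; apply: filter_le.
split.
- move=> x y; have [Fy|Fy] := pselect (F' y).
    have Fxy := up _ _ Fy (le_impl x y).
    by rewrite (twist_in Fxy) (twist_in Fy) impl_eq1// lex1.
  have [Fx|Fx] := pselect (F' x).
    have Fxy : ~ F' (impl x y) by move=> /(filter_mp FF')/(_ Fx).
    rewrite (twist_in Fx) impl1x !twist_out// fimpl.
    apply/le_anti/andP; split; last by apply: leI2 => //; apply: le_impl.
    rewrite lexI leIr andbT; apply: le_trans (implI_le (f x) (f y)).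
    by apply: leI2 => //; apply: F'_le.
  rewrite (twist_out Fx) (twist_out Fy).
  have [Fxy|Fxy] := pselect (F' (impl x y)).
    rewrite twist_in// impl_eq1// lexI leIr andbT meetC leI_impl -fimpl.
    exact: F'_le.
  have fxy1 : f (impl x y) <> \top.
    by move=> fxy; apply: (F'_nle Fx Fxy); rewrite fxy lex1.
  rewrite twist_out// (meet_idPl (opremum_c fxy1)).
  rewrite -{1}(impl_opremum (F'_nle Fx Fxy)) fimpl -impl_curry [c `&` _]meetC.
  apply/le_anti/andP; split; last by apply: impl_mono => //; apply: leIl.
  by rewrite -leI_impl lexI implI_le/= leIxr// leIr.
- move=> x y; have [Fx|Fx] := pselect (F' x); last first.
    rewrite [twist (_ `&` _)]twist_out; last first.
      by move=> Fxy; apply: Fx; apply: up Fxy _; apply: leIl.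
    rewrite fmeet (twist_out Fx); have [Fy|Fy] := pselect (F' y).
      rewrite (twist_in Fy) meetx1 -meetA; congr (_ `&` _).
      exact/meet_idPr/F'_le.
    by rewrite (twist_out Fy) meetACA meetxx.
  rewrite (twist_in Fx) meet1x; have [Fy|Fy] := pselect (F' y).
    by rewrite !twist_in//; apply: (filter2 FF' Fx Fy).
  rewrite !twist_out//; last first.
    by move=> Fxy; apply: Fy; apply: up Fxy _; apply: leIr.
  rewrite fmeet [f x `&` _]meetC -meetA; congr (_ `&` _).
  exact/meet_idPr/F'_le.
- move=> x y; have [Fx|Fx] := pselect (F' x).
    rewrite (twist_in Fx) twist_in ?join1x//.
    by apply: up Fx _; apply: leUl.
  have [Fy|Fy] := pselect (F' y).
    rewrite (twist_in Fy) twist_in ?joinx1//.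
    by apply: up Fy _; apply: leUr.
  rewrite !twist_out//; last by move=> /(prime_filterU pF')[].
  rewrite fjoin; apply/le_anti; rewrite brouwerian_meetUl/=.
  by rewrite leUx !leI2// ?leUl ?leUr.
- by rewrite twist_in//; apply: filter_top.
Qed.
End Twist.

(** * The theorem *)

Lemma image_subuniverse d (A B : brouwerianType d) (h : A -> B) :
  brouwerian_hom h -> subuniverse (range h).
Proof.
move=> [himpl hmeet hjoin h1]; split; first by exists \top.
- by move=> _ _ [x _ <-] [y _ <-]; exists (x `&` y).
- by move=> _ _ [x _ <-] [y _ <-]; exists (x `|` y).
- by move=> _ _ [x _ <-] [y _ <-]; exists (impl x y).
Qed.

Lemma finite_depth_bound d (K : brouwerianType d -> Prop) : finite_depth K ->
  forall B : brouwerianType d, K B ->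
  exists n, forall F : set B, prime_filter F -> prime_depth_le n F.
Proof.
move=> finK B KB; have [|[ubK _] [Koo|[n Kn]]] := @variety_depthP d K.
- by exists B.
- by move: finK; rewrite /finite_depth Koo ltxx.
exists n; apply: chain_size_bound => m Bm.
have [[ubB _] _] := depthP B.
have mB : ((Posz m)%:E <= depth B)%E by apply: ubB; exists m.
have BK : (depth B <= variety_depth K)%E by apply: ubK; exists B.
by have := le_trans mB BK; rewrite Kn lee_fin.
Qed.

Theorem theorem5p4 (d : Order.disp_t) (K : brouwerianType d -> Prop)
  (varK : variety K) (finK : finite_depth K)
  (A B : brouwerianType d) (h : A -> B) (epih : K_epimorphism K h) :
  forall b : B, exists a : A, h a = b.
Proof.
have [[KA KB homh] epi] := epih; move=> b; apply: contrapT => nhb.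
have [n dn] := finite_depth_bound finK KB.
have subS := image_subuniverse homh.
have [|F [F' [[pF pF' FF' nFF'] FT adj]]] := adjacent_twins (b := b) subS dn.
  by move=> [a _ ab]; apply: nhb; exists a.
have [c0 Fc c0P] := prime_opremum pF FT (dn _ pF).
(* An element of every prime filter properly above F has a class above that
   of c0, and an element outside F has one below it. *)
have above x : (forall G, prime_filter G -> F `<` G -> G x) -> F (impl c0 x).
  move=> xP; apply: contrapT => /(prime_impl pF.1)[G [pG FG Gc Gx]].
  exact/Gx/(xP _ pG)/(filter_properI FG Gc Fc).
pose f := quot_pi pF.1; pose c := f c0.
have homf := quot_pi_hom pF.1.
have opr z : z <> \top -> z <= c.
  have [x ->] := quot_pi_surj z; rewrite quot_pi_eq1 => Fx.
  rewrite le_quot_pi; apply/asboolP; apply: contrapT.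
  move=> /(prime_impl pF.1)[G [pG FG Gx Gc]].
  exact/Gc/(c0P _ pG)/(filter_properI FG Gx Fx).
have F'_le x : F' x -> c <= f x.
  move=> F'x; rewrite le_quot_pi; apply/asboolP/above => G pG FG.
  case: adj => [[_ cover]|same]; first exact: cover F'x.
  exact: ((same G pG).1 FG).1.
have F'_nle x y : ~ F' x -> ~ F' (impl x y) -> ~ c <= f (impl x y).
  move=> F'x F'xy; rewrite le_quot_pi => /asboolP Fcxy.
  suff [G [pG FG Gxy]] : exists G,
      [/\ prime_filter G, F `<` G & ~ G (impl x y)].
    exact: Gxy (filter_mp pG.1 (FG.1 _ Fcxy) (c0P _ pG FG)).
  case: adj => [[FltF' _]|same]; first by exists F'.
  have [G [pG F'G Gx Gy]] := prime_impl pF'.1 F'xy.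
  exists G; split=> //; first exact: (same G pG).2 (filter_properI F'G Gx F'x).
  by move=> /(filter_mp pG.1)/(_ Gx).
pose g := twist f c F'.
have homg : brouwerian_hom g by apply: twist_hom.
have KC : K (filter_quot pF.1) by apply: variety_quot.
have fg : f =1 g.
  apply: epi => // a /=; rewrite /g /twist; case: asboolP => F'ha.
    apply/quot_pi_eq1; suff [] : (F `&` range h) (h a) by [].
    by rewrite FF'; split=> //; exists a.
  apply/esym/meet_idPl/opr; rewrite quot_pi_eq1 => Fha; apply: F'ha.
  by have [] : (F' `&` range h) (h a) by rewrite -FF'; split=> //; exists a.
have cn1 : c <> \top by move=> /quot_pi_eq1.
apply: nFF'; apply/seteqP; split=> x Fx.
  apply: contrapT => F'x; apply: cn1.
  have fx1 : f x = \top by apply/quot_pi_eq1.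
  by have := fg x; rewrite /g twist_out// fx1 meet1x.
by apply/(quot_pi_eq1 pF.1); have := fg x; rewrite /g twist_in.
Qed.
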